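(* Let $k\ge 1$ and $l\ge 1$ be integers, let $\mu'=(\mu'_1,\ldots,\mu'_k)$ be a partition, and let $\mu=(\mu'_1,\ldots,\mu'_k,1^l)$ be the partition obtained by appending $l$ parts equal to $1$. For a filling $T$ of shape $\mu$, let $T'$ be the filling of shape $\mu'$ given by $T'_{i,j}=T_{i,j}$ for $(i,j)\in\mu'$, and let $T''$ be the filling of shape $(1^l)$ given by $T''_{i,1}=T_{k+i,1}$ for $1\le i\le l$. Then for every filling $T$ of shape $\mu$, \[ \operatorname{maj}(T)\equiv \operatorname{maj}(T')+\operatorname{maj}(T'')\pmod{l} \quad\text{and}\quad \operatorname{inv}(T)=\operatorname{inv}(T')+\operatorname{inv}(T''). \]
   Context: Diagrams are in French convention: the diagram of a partition $\lambda=(\lambda_1\ge\cdots\ge\lambda_r>0)$ is the set of cells $(i,j)$ with $1\le i\le r$, $1\le j\le\lambda_i$ (row $i$ counted from the bottom, column $j$ from the left). For a cell $u=(i,j)$, $\operatorname{arm}(u)=\lambda_i-j$ is the number of cells strictly to its right and $\operatorname{leg}(u)$ is the number of cells of the diagram strictly above it in column $j$. A filling $T$ of shape $\lambda$ assigns a positive integer $T_{i,j}$ to each cell, with no monotonicity condition. A descent of $T$ is a cell $(i,j)$ with $i\ge 2$ and $T_{i,j}>T_{i-1,j}$; $\operatorname{Des}(T)$ is the set of descents and $\operatorname{maj}(T)=\sum_{u\in\operatorname{Des}(T)}(\operatorname{leg}(u)+1)$. Two distinct cells attack each other if they lie in the same row, or if they are of the form $(i,k)$ and $(i-1,j)$ with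 $j<k$ (consecutive rows, the upper cell strictly to the right of the lower one). The reading order reads rows from top to bottom and each row from left to right. A pair $(u,v)$ of cells is an inversion if $u,v$ attack each other, $T_u<T_v$, and $v$ precedes $u$ in the reading order; $\operatorname{Inv}(T)$ denotes the number of inversions, and $\operatorname{inv}(T)=\operatorname{Inv}(T)-\sum_{u\in\operatorname{Des}(T)}\operatorname{arm}(u)$. These statistics are computed with respect to the shape of the filling in question ($\mu$, $\mu'$ or $(1^l)$). *)

(* Defs.v *)
From mathcomp Require Import all_boot all_order all_algebra.

Set Implicit Arguments.
Unset Strict Implicit.
Unset Printing Implicit Defensive.


Definition is_partition (la : seq nat) : bool := sorted geq la && (0 \notin la).

(* A cell is (row, column), both numbered from 1. *)
Definition cell : Type := (nat * nat)%type.

Definition row_len (la : seq nat) (i : nat) : nat := nth 0 la i.-1.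

Definition diagram (la : seq nat) : seq cell :=
  [seq (i, j) | i <- iota 1 (size la), j <- iota 1 (row_len la i)].

Definition arm (la : seq nat) (u : cell) : nat := row_len la u.1 - u.2.

Definition leg (la : seq nat) (u : cell) : nat :=
  count (fun v : cell => (v.2 == u.2) && (u.1 < v.1)) (diagram la).

(* The values of [entry] outside [diagram la] are irrelevant: all the
   statistics below only look at cells of the diagram. *)
Record filling (la : seq nat) : Type := Filling {
  entry :> cell -> nat;
  entry_gt0 : forall u : cell, u \in diagram la -> 0 < entry u
}.

Definition Des (la : seq nat) (T : filling la) : seq cell :=
  [seq u <- diagram la | (2 <= u.1) && (T (u.1.-1, u.2) < T u)].

Definition maj (la : seq nat) (T : filling la) : nat :=
  \sum_(u <- Des T) (leg la u + 1).

(* [u] is in the row just above that of [v], strictly to the right of [v]. *)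
Definition upper_right (u v : cell) : bool := (u.1 == v.1.+1) && (v.2 < u.2).

Definition attack (u v : cell) : bool :=
  (u != v) && [|| u.1 == v.1, upper_right u v | upper_right v u].

(* Reading order: top row (largest row index) first, left to right in a row. *)
Definition precedes (v u : cell) : bool :=
  (u.1 < v.1) || ((v.1 == u.1) && (v.2 < u.2)).

Definition inversions (la : seq nat) (T : filling la) : seq (cell * cell) :=
  [seq p <- [seq (u, v) | u <- diagram la, v <- diagram la] |
    [&& attack p.1 p.2, T p.1 < T p.2 & precedes p.2 p.1]].

Definition Inv (la : seq nat) (T : filling la) : nat := size (inversions T).

Definition inv_stat (la : seq nat) (T : filling la) : int :=
  ((Inv T)%:Z - (\sum_(u <- Des T) arm la u)%:Z)%R.

(* Main.v *)
Require Import Defs.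
From mathcomp Require Import all_boot all_order all_algebra.
From mathcomp Require Import zify.

(** The diagram of [mu] is the diagram of [mu'] followed by a column of height
    [l] placed on top of its first column.  Adding this column changes the leg
    of a cell of [mu'] by [0] or [l], and the only descent condition not seen by
    [T'] or [T''] is the one at the lowest added cell, which contributes [l] to
    [maj].  The added cells have arm [0], and since they lie in column [1], none
    of them attacks a cell of [mu'] or another added cell. *)

(** With [k = size la], this is the position in the diagram of [la ++ nu] of a cell of [nu]. *)
Definition raise (k : nat) (u : cell) : cell := (k + u.1, u.2).

(** Takes a bare function, so that fillings of different shapes can be compared. *)
Definition is_descent (f : cell -> nat) (u : cell) : bool :=
  (2 <= u.1) && (f (u.1.-1, u.2) < f u).

Definition is_inversion (f : cell -> nat) (u v : cell) : bool :=
  [&& attack u v, f u < f v & precedes v u].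

Lemma mem_diagram (la : seq nat) (u : cell) :
  (u \in diagram la) = (0 < u.1 <= size la) && (0 < u.2 <= row_len la u.1).
Proof.
case: u => i j /=; rewrite /diagram; apply/allpairsPdep/idP.
  by case=> x [y []]; rewrite !mem_iota => hx hy [-> ->]; lia.
by case/andP=> hi hj; exists i, j; rewrite !mem_iota; split=> //; lia.
Qed.

(** Holds as an equality of lists because rows are listed from the bottom; sums and counts then
    split directly. *)
Lemma diagram_cat (la nu : seq nat) :
  diagram (la ++ nu) = diagram la ++ map (raise (size la)) (diagram nu).
Proof.
rewrite /diagram size_cat iotaD map_cat flatten_cat; congr (_ ++ _).
  congr flatten; apply/eq_in_map => i; rewrite mem_iota => hi.
  rewrite /row_len nth_cat; suff -> : i.-1 < size la by [].
  lia.
rewrite map_allpairs addnC iotaDl -map_comp; congr flatten.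
apply/eq_in_map => i; rewrite mem_iota => hi /=.
rewrite /row_len nth_cat; have -> : (size la + i).-1 < size la = false by lia.
by have -> : (size la + i).-1 - size la = i.-1 by lia.
Qed.

Lemma diagram_nseq1 (l : nat) : diagram (nseq l 1) = [seq (i, 1) | i <- iota 1 l].
Proof.
rewrite /diagram size_nseq.
have -> : [seq (i, j) | i <- iota 1 l, j <- iota 1 (row_len (nseq l 1) i)]
   = [seq (i, j) | i <- iota 1 l, j <- [:: 1]].
  congr flatten; apply/eq_in_map => i; rewrite mem_iota => hi.
  rewrite /row_len nth_nseq; have -> // : i.-1 < l by lia.
by elim: (iota 1 l) => //= i s <-.
Qed.

Lemma mem_diagram_nseq1 (l : nat) (u : cell) :
  (u \in diagram (nseq l 1)) = (0 < u.1 <= l) && (u.2 == 1).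
Proof.
rewrite mem_diagram size_nseq /row_len nth_nseq.
by case: ifP => h; lia.
Qed.

(** Row lengths decrease weakly. Hence the descent condition at a cell of [mu'] involves only cells
    of [mu'], where [T] and [T'] agree. *)
Lemma diagram_below (la : seq nat) (i j : nat) :
  is_partition la -> 2 <= i -> (i, j) \in diagram la -> (i.-1, j) \in diagram la.
Proof.
case/andP=> hla _ hi; rewrite !mem_diagram /= => /andP[hs hj].
have geq_trans : transitive geq by move=> y x z /= h1 h2; exact: leq_trans h2 h1.
have : nth 0 la i.-1 <= nth 0 la i.-2.
  by apply: (sorted_leq_nth geq_trans leqnn 0 hla); rewrite ?inE; lia.
by rewrite /row_len in hj *; lia.
Qed.

Lemma leg_cat (la nu : seq nat) (u : cell) : u.1 <= size la ->
  leg (la ++ nu) u = leg la u + count (fun v => v.2 == u.2) (diagram nu).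
Proof.
move=> hu; rewrite /leg diagram_cat count_cat count_map; congr (_ + _).
apply: eq_in_count => -[i j]; rewrite mem_diagram /= => hv.
have -> : u.1 < size la + i by lia.
by rewrite andbT.
Qed.

Lemma leg_raise (la nu : seq nat) (u : cell) :
  leg (la ++ nu) (raise (size la) u) = leg nu u.
Proof.
rewrite /leg diagram_cat count_cat count_map /=.
rewrite (_ : count _ (diagram la) = 0) ?add0n; last first.
  apply/eqP; rewrite -leqn0 leqNgt -has_count; apply/hasPn => -[i j].
  by rewrite mem_diagram /= => hv; lia.
by apply: eq_count => v /=; rewrite ltn_add2l.
Qed.

Lemma leg_nseq1_bottom (l : nat) : leg (nseq l 1) (1, 1) = l.-1.
Proof.
rewrite /leg diagram_nseq1 count_map; case: l => //= l.
rewrite -[RHS](size_iota 2 l); apply/eqP; rewrite -all_count; apply/allP => i /=.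
by rewrite mem_iota; lia.
Qed.

Lemma arm_cat (la nu : seq nat) (u : cell) :
  u \in diagram la -> arm (la ++ nu) u = arm la u.
Proof.
rewrite mem_diagram /arm /row_len nth_cat => hu.
by have -> : u.1.-1 < size la by lia.
Qed.

Lemma arm_raise (la nu : seq nat) (u : cell) :
  0 < u.1 -> arm (la ++ nu) (raise (size la) u) = arm nu u.
Proof.
move=> hu; rewrite /arm /row_len nth_cat /=.
have -> : (size la + u.1).-1 < size la = false by lia.
by congr (nth _ _ _ - _); lia.
Qed.

Lemma arm_nseq1 (l : nat) (u : cell) : u \in diagram (nseq l 1) -> arm (nseq l 1) u = 0.
Proof.
rewrite mem_diagram_nseq1 /arm /row_len nth_nseq => hu.
by case: ifP; lia.
Qed.

(** This is the growth of the leg of a cell in column [j] when the column is added: a multiple of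
    [l], invisible modulo [l]. *)
Lemma count_column_nseq1 (l j : nat) :
  count (fun v => v.2 == j) (diagram (nseq l 1)) = l * (j == 1).
Proof.
rewrite diagram_nseq1 count_map.
rewrite (@eq_count _ _ (fun=> j == 1)); last by move=> i /=; rewrite eq_sym.
by case: (j == 1); rewrite ?count_predT ?count_pred0 ?size_iota ?muln1 ?muln0.
Qed.

(** Sums over the whole diagram can be split by [diagram_cat]. *)
Lemma sum_Des (la : seq nat) (T : filling la) (F : cell -> nat) :
  \sum_(u <- Des T) F u = \sum_(u <- diagram la) (if is_descent T u then F u else 0).
Proof. by rewrite /Des big_filter -big_mkcond. Qed.

Lemma Inv_sum (la : seq nat) (T : filling la) :
  Inv T = \sum_(u <- diagram la) \sum_(v <- diagram la) is_inversion T u v.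
Proof.
rewrite /Inv /inversions size_filter -sum1_count big_mkcond big_allpairs_dep.
by apply: eq_bigr => u _; apply: eq_bigr => v _ /=; rewrite /is_inversion; case: ifP.
Qed.

Lemma eq_modn_sum (I : eqType) (r : seq I) (d : nat) (F G : I -> nat) :
  (forall i, i \in r -> F i = G i %[mod d]) ->
  \sum_(i <- r) F i = \sum_(i <- r) G i %[mod d].
Proof.
move=> h; rewrite -modn_summ -[in RHS]modn_summ; congr (_ %% _).
exact: eq_big_seq.
Qed.

Theorem theorem3 (k l : nat) (hk : 1 <= k) (hl : 1 <= l)
    (mu' : seq nat) (hmu' : is_partition mu') (hsize : size mu' = k)
    (T : filling (mu' ++ nseq l 1))
    (T' : filling mu')
    (hT' : forall u : cell, u \in diagram mu' -> T' u = T u)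
    (T'' : filling (nseq l 1))
    (hT'' : forall i : nat, 1 <= i <= l -> T'' (i, 1) = T (k + i, 1)) :
  maj T = maj T' + maj T'' %[mod l] /\
  inv_stat T = (inv_stat T' + inv_stat T'')%R.
Proof.
subst k.
have raiseT (u : cell) : u \in diagram (nseq l 1) -> T'' u = T (raise (size mu') u).
  by case: u => i j; rewrite mem_diagram_nseq1 /= => /andP[hi /eqP->]; exact: hT''.
have desT' (u : cell) : u \in diagram mu' -> is_descent T u = is_descent T' u.
  case: u => i j hu; rewrite /is_descent /=; case: leqP => //= hi.
  by rewrite !hT' //; exact: diagram_below hu.
(* The bottom added cell is excluded: [T] compares it with a cell of [mu'], whereas in [T''] it lies
   in row 1 and is never a descent. *)
have desT'' (u : cell) : u \in diagram (nseq l 1) -> 1 < u.1 ->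
    is_descent T (raise (size mu') u) = is_descent T'' u.
  case: u => i j hu /= hi; rewrite /is_descent /=.
  have hv : (i.-1, j) \in diagram (nseq l 1).
    by move: hu; rewrite !mem_diagram_nseq1 /=; lia.
  rewrite !raiseT //.
  rewrite /raise /= hi (_ : (size mu' + i).-1 = size mu' + i.-1); last by lia.
  by have -> : 1 < size mu' + i by lia.
split.
  rewrite /maj !sum_Des diagram_cat big_cat big_map /=.
  rewrite -modnDm -[in RHS]modnDm; congr ((_ + _) %% _); apply: eq_modn_sum => u hu.
    rewrite desT' //; case: ifP => // _.
    rewrite leg_cat; last by move: hu; rewrite mem_diagram; lia.
    by rewrite count_column_nseq1 addnAC mulnC addnC modnMDl.
  rewrite leg_raise; have [hu1|hu1] := ltnP 1 u.1; first by rewrite desT''.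
  have -> : u = (1, 1).
    by case: u hu hu1 => i j; rewrite mem_diagram_nseq1 /= => h h1; congr (_, _); lia.
  (* A descent of [T] at this cell contributes exactly [l], which is 0 modulo [l]. *)
  rewrite leg_nseq1_bottom addn1 prednK //=.
  by case: ifP => _; rewrite ?modnn ?mod0n.
rewrite /inv_stat.
have -> : Inv T = Inv T' + Inv T''.
  rewrite !Inv_sum diagram_cat big_cat big_map /=; congr (_ + _).
    apply: eq_big_seq => u hu; rewrite big_cat big_map /= [X in _ + X]big1_seq ?addn0.
      by apply: eq_big_seq => v hv; rewrite /is_inversion !hT'.
    (* The two cells lie in different rows, so an attack would need the added cell, in column 1,
       strictly to the right of the other one. *)
    move=> v /= hv; move: hu hv; rewrite mem_diagram_nseq1 mem_diagram.
    rewrite /is_inversion /attack /upper_right /=; lia.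
  apply: eq_big_seq => u hu; rewrite big_cat big_map /= [X in X + _]big1_seq ?add0n.
    (* Attack and reading order only compare rows and columns, so raising both cells preserves
       them. *)
    apply: eq_big_seq => v hv; rewrite /is_inversion !raiseT //.
    move: hu hv; rewrite !mem_diagram_nseq1 /attack /upper_right /precedes /raise.
    by case: u v => [i j] [i' j'] /=; rewrite !xpair_eqE; lia.
  move=> v /= hv; move: hu hv; rewrite mem_diagram_nseq1 mem_diagram.
  rewrite /is_inversion /attack /upper_right /=; lia.
have -> : \sum_(u <- Des T) arm (mu' ++ nseq l 1) u =
    \sum_(u <- Des T') arm mu' u + \sum_(u <- Des T'') arm (nseq l 1) u.
  rewrite !sum_Des diagram_cat big_cat big_map /=; congr (_ + _).
    by apply: eq_big_seq => u hu; rewrite desT' // arm_cat.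
  apply: eq_big_seq => u hu.
  rewrite arm_raise; last by move: hu; rewrite mem_diagram_nseq1; lia.
  (* Since the arm is 0, a disagreement of [T] and [T''] on the bottom descent does not matter. *)
  by rewrite arm_nseq1 // !if_same.
lia.
Qed.
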